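(* Let $(\mathcal{C},\otimes,\phi)$ be a braided monoidal category which admits split idempotents and let $H\in\mathcal{C}$ be a braided Hopf algebra with bijective antipode. Assume $H$ is flat. Suppose $B$ is an $H$-bicomodule algebra in $\mathcal{C}$, with right coaction $\rho:B\to B\otimes H$ and left coaction $\lambda:B\to H\otimes B$, such that there exists an $H$-bicolinear algebra morphism $v:H\to B$. Let $E=\nabla_B\circ(B\otimes(v\circ S))\circ\rho:B\to B$, which is an idempotent, and let $(B_0,i,p)$ be its splitting: $i:B_0\to B$, $p:B\to B_0$, $p\circ i=id_{B_0}$, $i\circ p=E$. Equip $B_0$ with - the multiplication $\nabla_0=p\circ\nabla_B\circ(i\otimes i)$ and the unit $p\circ\eta_B$; - the $H$-action $ad_0=p\circ ad\circ(H\otimes i)$, where $ad=\nabla_B\circ(\nabla_B\otimes B)\circ(v\otimes B\otimes(v\circ S))\circ(H\otimes\phi_{H,B})\circ(\Delta\otimes B):H\otimes B\to B$; - the $H$-coaction $\lambda_0:B_0\to H\otimes B_0$ determined by $(H\otimes i)\circ\lambda_0=\lambda\circ i$. Then $B_0\in{}_H^H\mathcal{YD}(\mathcal{C})$ is a Yetter-Drinfeld module algebra, and the morphism $\omega=\nabla_B\circ(i\otimes v):B_0\# H\to B$ is an isomorphism of $H$-bicomodule algebras, where $B_0\# H$ has the left and right coactions $$\lambda_{B_0\# H}=(\nabla_H\otimes B_0\otimes H)\circ(H\otimes\phi_{B_0,H}\otimes H)\circ(\lambda_0\otimes\Delta),\qquad \rho_{B_0\# H}=B_0\otimes\Delta.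$$
   Context: $\mathcal{C}$ is a braided monoidal category with unit object $I$ and braiding $\phi_{M,N}:M\otimes N\to N\otimes M$; by coherence the associativity and unit constraints are suppressed. An object's name also denotes its identity morphism. $\mathcal{C}$ admits split idempotents if for each idempotent $e:X\to X$ there are an object $X_e$ and morphisms $i_e:X_e\to X$, $p_e:X\to X_e$ with $p_ei_e=id$, $i_ep_e=e$. ''$H$ is flat'' means that the functor $H\otimes-$ preserves equalizers. An algebra $A$ has multiplication $\nabla_A$ and unit $\eta_A$; a coalgebra has comultiplication $\Delta$ and counit $\varepsilon$. A braided Hopf algebra $H$ in $\mathcal{C}$ is an algebra and a coalgebra such that $\Delta$ and $\varepsilon$ are algebra morphisms (so $\Delta\nabla=(\nabla\otimes\nabla)(H\otimes\phi_{H,H}\otimes H)(\Delta\otimes\Delta)$, $\varepsilon\nabla=\varepsilon\otimes\varepsilon$, and $\Delta,\varepsilon$ preserve units), with an antipode $S:H\to H$ in $\mathcal{C}$ satisfying $\nabla(S\otimes H)\Delta=\nabla(H\otimes S)\Delta=\eta\varepsilon$. Left $H$-module algebra: an algebra $A$ with a left $H$-module structure $\mu:H\otimes A\to A$ such that $\mu(H\otimes\nabla_A)=\nabla_A(\mu\otimes\mu)(H\otimes\phi_{H,A}\otimes A)(\Delta\otimes A\otimes A)$ and $\mu(H\otimes\eta_A)=\eta_A\varepsilon$. Its smash product $A\# H$ is $A\otimes H$ with unit $\eta_A\otimes\eta_H$ and multiplication $(\nabla_A\otimes\nabla_H)(A\otimes\mu\otimes H\otimes H)(A\otimes H\otimes\phi_{H,A}\otimes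 H)(A\otimes\Delta\otimes A\otimes H)$. Left $H$-comodule algebra: an algebra $A$ with a left $H$-comodule structure $\lambda:A\to H\otimes A$ such that $\lambda\nabla_A=(\nabla_H\otimes\nabla_A)(H\otimes\phi_{A,H}\otimes A)(\lambda\otimes\lambda)$ and $\lambda\eta_A=\eta_H\otimes\eta_A$. Right $H$-comodule algebra: an algebra $A$ with a right $H$-comodule structure $\rho:A\to A\otimes H$ such that $\rho\nabla_A=(\nabla_A\otimes\nabla_H)(A\otimes\phi_{H,A}\otimes H)(\rho\otimes\rho)$ and $\rho\eta_A=\eta_A\otimes\eta_H$. $H$-bicomodule algebra: both, with $(H\otimes\rho)\lambda=(\lambda\otimes H)\rho$. Morphisms of $H$-bicomodule algebras are algebra morphisms that are left and right $H$-colinear (''$H$-bicolinear''). $H$ is an $H$-bicomodule algebra via $\Delta$ on both sides. ${}_H^H\mathcal{YD}(\mathcal{C})$ is the category of left-left Yetter-Drinfeld modules: objects $M$ that are left $H$-modules ($\mu$) and left $H$-comodules ($\lambda$) in $\mathcal{C}$ with $(\nabla\otimes\mu)(H\otimes\phi_{H,H}\otimes M)(\Delta\otimes\lambda)=(\nabla\otimes M)(H\otimes\phi_{M,H})(\lambda\otimes H)(\mu\otimes H)(H\otimes\phi_{H,M})(\Delta\otimes M)$; morphisms are the $H$-linear $H$-colinear morphisms. It is monoidal with the diagonal action and coaction. A Yetter-Drinfeld module algebra is an algebra in ${}_H^H\mathcal{YD}(\mathcal{C})$; equivalently, an object of ${}_H^H\mathcal{YD}(\mathcal{C})$ that is an algebra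 in $\mathcal C$ and is both a left $H$-module algebra and a left $H$-comodule algebra. For such $A$, $A\# H$ with the coactions of the form displayed in the claim is an $H$-bicomodule algebra. *)

(* Defs.v *)
From mathcomp Require Import ssreflect ssrfun ssrbool.

Set Implicit Arguments.
Unset Strict Implicit.
Unset Printing Implicit Defensive.

Declare Scope ob_scope.
Delimit Scope ob_scope with ob.
Declare Scope hom_scope.
Delimit Scope hom_scope with hom.

Record Category := {
  obj :> Type;
  hom : obj -> obj -> Type;
  idm : forall X, hom X X;
  comp : forall X Y Z, hom Y Z -> hom X Y -> hom X Z;
  comp1m : forall X Y (f : hom X Y), comp (idm Y) f = f;
  compm1 : forall X Y (f : hom X Y), comp f (idm X) = f;
  compA : forall X Y Z W (h : hom Z W) (g : hom Y Z) (f : hom X Y),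
    comp h (comp g f) = comp (comp h g) f
}.

Bind Scope ob_scope with obj.
Bind Scope hom_scope with hom.
Arguments hom {c} X%_ob Y%_ob.
Arguments idm {c} X%_ob.
Arguments comp {c X Y Z} (g f)%_hom.
Notation "X ~> Y" := (hom X Y) (at level 70) : type_scope.
Notation "g ∘ f" := (comp g f) (at level 40, left associativity) : hom_scope.
Local Open Scope hom_scope.

Record MonoidalCategory := {
  mcat :> Category;
  tens : mcat -> mcat -> mcat;
  munit : mcat;
  tensm : forall (X X' Y Y' : mcat),
    X ~> X' -> Y ~> Y' -> tens X Y ~> tens X' Y';
  tensm1 : forall X Y : mcat, tensm (idm X) (idm Y) = idm (tens X Y);
  tensmM : forall (X X' X'' Y Y' Y'' : mcat)
      (f' : X' ~> X'') (f : X ~> X') (g' : Y' ~> Y'') (g : Y ~> Y'),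
    tensm (f' ∘ f) (g' ∘ g) = tensm f' g' ∘ tensm f g;
  assoc : forall X Y Z : mcat, tens (tens X Y) Z ~> tens X (tens Y Z);
  associ : forall X Y Z : mcat, tens X (tens Y Z) ~> tens (tens X Y) Z;
  assocK : forall X Y Z, associ X Y Z ∘ assoc X Y Z = idm _;
  associK : forall X Y Z, assoc X Y Z ∘ associ X Y Z = idm _;
  assoc_nat : forall (X X' Y Y' Z Z' : mcat)
      (f : X ~> X') (g : Y ~> Y') (h : Z ~> Z'),
    assoc X' Y' Z' ∘ tensm (tensm f g) h = tensm f (tensm g h) ∘ assoc X Y Z;
  lunit : forall X : mcat, tens munit X ~> X;
  luniti : forall X : mcat, X ~> tens munit X;
  lunitK : forall X, luniti X ∘ lunit X = idm _;
  lunitiK : forall X, lunit X ∘ luniti X = idm _;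
  lunit_nat : forall (X X' : mcat) (f : X ~> X'),
    lunit X' ∘ tensm (idm munit) f = f ∘ lunit X;
  runit : forall X : mcat, tens X munit ~> X;
  runiti : forall X : mcat, X ~> tens X munit;
  runitK : forall X, runiti X ∘ runit X = idm _;
  runitiK : forall X, runit X ∘ runiti X = idm _;
  runit_nat : forall (X X' : mcat) (f : X ~> X'),
    runit X' ∘ tensm f (idm munit) = f ∘ runit X;
  pentagon : forall W X Y Z : mcat,
    assoc W X (tens Y Z) ∘ assoc (tens W X) Y Z
    = tensm (idm W) (assoc X Y Z) ∘ assoc W (tens X Y) Z
      ∘ tensm (assoc W X Y) (idm Z);
  triangle : forall X Y : mcat,
    tensm (idm X) (lunit Y) ∘ assoc X munit Y = tensm (runit X) (idm Y)
}.

Arguments tens {m} (X Y)%_ob.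
Arguments munit {m}.
Arguments tensm {m X X' Y Y'} (f g)%_hom.
Arguments assoc {m} (X Y Z)%_ob.
Arguments associ {m} (X Y Z)%_ob.
Arguments lunit {m} X%_ob.
Arguments luniti {m} X%_ob.
Arguments runit {m} X%_ob.
Arguments runiti {m} X%_ob.
Notation "X ⊗ Y" := (tens X Y) (at level 38, left associativity) : ob_scope.
Notation "f ⊗ g" := (tensm f g) (at level 38, left associativity) : hom_scope.

Record BraidedCategory := {
  bcat :> MonoidalCategory;
  braid : forall X Y : bcat, X ⊗ Y ~> Y ⊗ X;
  braidi : forall X Y : bcat, Y ⊗ X ~> X ⊗ Y;
  braidK : forall X Y, braidi X Y ∘ braid X Y = idm _;
  braidiK : forall X Y, braid X Y ∘ braidi X Y = idm _;
  braid_nat : forall (X X' Y Y' : bcat) (f : X ~> X') (g : Y ~> Y'),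
    braid X' Y' ∘ (f ⊗ g) = (g ⊗ f) ∘ braid X Y;
  hexagon_r : forall X Y Z : bcat,
    assoc Y Z X ∘ braid X (Y ⊗ Z) ∘ assoc X Y Z
    = (idm Y ⊗ braid X Z) ∘ assoc Y X Z ∘ (braid X Y ⊗ idm Z);
  hexagon_l : forall X Y Z : bcat,
    associ Z X Y ∘ braid (X ⊗ Y) Z ∘ associ X Y Z
    = (braid X Z ⊗ idm Y) ∘ associ X Z Y ∘ (idm X ⊗ braid Y Z)
}.

Arguments braid {b} (X Y)%_ob.
Arguments braidi {b} (X Y)%_ob.

Section CategoryNotions.
Variable C : Category.

Definition is_iso (X Y : C) (f : X ~> Y) : Prop :=
  exists g : Y ~> X, g ∘ f = idm X /\ f ∘ g = idm Y.

Definition idempotent (X : C) (e : X ~> X) : Prop := e ∘ e = e.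

Definition splits (X : C) (e : X ~> X) (Y : C) (i : Y ~> X) (p : X ~> Y)
  : Prop := p ∘ i = idm Y /\ i ∘ p = e.

Definition admits_split_idempotents : Prop :=
  forall (X : C) (e : X ~> X), idempotent e ->
    exists (Y : C) (i : Y ~> X) (p : X ~> Y), splits e i p.

Definition is_equalizer (X Y E : C) (f g : X ~> Y) (e : E ~> X) : Prop :=
  f ∘ e = g ∘ e /\
  forall (Z : C) (h : Z ~> X), f ∘ h = g ∘ h -> exists! k : Z ~> E, e ∘ k = h.

End CategoryNotions.

Definition flat (C : MonoidalCategory) (H : C) : Prop :=
  forall (X Y E : C) (f g : X ~> Y) (e : E ~> X),
    is_equalizer f g e ->
    is_equalizer (idm H ⊗ f) (idm H ⊗ g) (idm H ⊗ e).

(* [W ⊗ φ_{X,Y} ⊗ Z] with its associativity constraints. *)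
Definition midbraid (C : BraidedCategory) (W X Y Z : C) :
    (W ⊗ X) ⊗ (Y ⊗ Z) ~> (W ⊗ Y) ⊗ (X ⊗ Z) :=
  associ W Y (X ⊗ Z)
  ∘ (idm W ⊗ (assoc Y X Z ∘ (braid X Y ⊗ idm Z) ∘ associ X Y Z))
  ∘ assoc W X (Y ⊗ Z).

Record is_algebra (C : MonoidalCategory) (A : C)
    (mul : A ⊗ A ~> A) (unit : munit ~> A) : Prop := {
  algA : mul ∘ (mul ⊗ idm A) = mul ∘ (idm A ⊗ mul) ∘ assoc A A A;
  alg1m : mul ∘ (unit ⊗ idm A) = lunit A;
  algm1 : mul ∘ (idm A ⊗ unit) = runit A
}.

Record is_coalgebra (C : MonoidalCategory) (A : C)
    (comul : A ~> A ⊗ A) (counit : A ~> munit) : Prop := {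
  coalgA : assoc A A A ∘ (comul ⊗ idm A) ∘ comul = (idm A ⊗ comul) ∘ comul;
  coalg1m : (counit ⊗ idm A) ∘ comul = luniti A;
  coalgm1 : (idm A ⊗ counit) ∘ comul = runiti A
}.

Record is_algebra_morphism (C : MonoidalCategory) (A B : C)
    (mulA : A ⊗ A ~> A) (unitA : munit ~> A)
    (mulB : B ⊗ B ~> B) (unitB : munit ~> B) (f : A ~> B) : Prop := {
  morM : f ∘ mulA = mulB ∘ (f ⊗ f);
  mor1 : f ∘ unitA = unitB
}.

Record HopfAlgebra (C : BraidedCategory) := {
  hopf_obj :> obj C;
  mulH : hopf_obj ⊗ hopf_obj ~> hopf_obj;
  unitH : munit ~> hopf_obj;
  comulH : hopf_obj ~> hopf_obj ⊗ hopf_obj;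
  counitH : hopf_obj ~> munit;
  antipode : hopf_obj ~> hopf_obj;
  hopf_alg : is_algebra mulH unitH;
  hopf_coalg : is_coalgebra comulH counitH;
  comul_mul : comulH ∘ mulH
    = (mulH ⊗ mulH) ∘ midbraid hopf_obj hopf_obj hopf_obj hopf_obj
      ∘ (comulH ⊗ comulH);
  comul_unit : comulH ∘ unitH = (unitH ⊗ unitH) ∘ luniti munit;
  counit_mul : counitH ∘ mulH = lunit munit ∘ (counitH ⊗ counitH);
  counit_unit : counitH ∘ unitH = idm munit;
  antipode_l : mulH ∘ (antipode ⊗ idm hopf_obj) ∘ comulH = unitH ∘ counitH;
  antipode_r : mulH ∘ (idm hopf_obj ⊗ antipode) ∘ comulH = unitH ∘ counitH
}.

Arguments mulH {C} h.
Arguments unitH {C} h.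
Arguments comulH {C} h.
Arguments counitH {C} h.
Arguments antipode {C} h.

Section HopfNotions.
Variables (C : BraidedCategory) (H : HopfAlgebra C).

Record is_module (M : C) (mu : H ⊗ M ~> M) : Prop := {
  modA : mu ∘ (mulH H ⊗ idm M) = mu ∘ (idm H ⊗ mu) ∘ assoc H H M;
  mod1 : mu ∘ (unitH H ⊗ idm M) = lunit M
}.

Record is_left_comodule (M : C) (lam : M ~> H ⊗ M) : Prop := {
  lcomodA : assoc H H M ∘ (comulH H ⊗ idm M) ∘ lam = (idm H ⊗ lam) ∘ lam;
  lcomod1 : (counitH H ⊗ idm M) ∘ lam = luniti M
}.

Record is_right_comodule (M : C) (rho : M ~> M ⊗ H) : Prop := {
  rcomodA : assoc M H H ∘ (rho ⊗ idm H) ∘ rho = (idm M ⊗ comulH H) ∘ rho;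
  rcomod1 : (idm M ⊗ counitH H) ∘ rho = runiti M
}.

Definition is_linear (M N : C) (muM : H ⊗ M ~> M) (muN : H ⊗ N ~> N)
    (f : M ~> N) : Prop := f ∘ muM = muN ∘ (idm H ⊗ f).

Definition is_left_colinear (M N : C) (lamM : M ~> H ⊗ M) (lamN : N ~> H ⊗ N)
    (f : M ~> N) : Prop := lamN ∘ f = (idm H ⊗ f) ∘ lamM.

Definition is_right_colinear (M N : C) (rhoM : M ~> M ⊗ H) (rhoN : N ~> N ⊗ H)
    (f : M ~> N) : Prop := rhoN ∘ f = (f ⊗ idm H) ∘ rhoM.

Record is_module_algebra (A : C) (mulA : A ⊗ A ~> A) (unitA : munit ~> A)
    (mu : H ⊗ A ~> A) : Prop := {
  modalg_alg : is_algebra mulA unitA;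
  modalg_mod : is_module mu;
  modalg_mul : mu ∘ (idm H ⊗ mulA)
    = mulA ∘ (mu ⊗ mu) ∘ midbraid H H A A ∘ (comulH H ⊗ idm (A ⊗ A));
  modalg_unit : mu ∘ (idm H ⊗ unitA) = unitA ∘ counitH H ∘ runit H
}.

Record is_left_comodule_algebra (A : C) (mulA : A ⊗ A ~> A)
    (unitA : munit ~> A) (lam : A ~> H ⊗ A) : Prop := {
  lcomodalg_alg : is_algebra mulA unitA;
  lcomodalg_comod : is_left_comodule lam;
  lcomodalg_mul : lam ∘ mulA
    = (mulH H ⊗ mulA) ∘ midbraid H A H A ∘ (lam ⊗ lam);
  lcomodalg_unit : lam ∘ unitA = (unitH H ⊗ unitA) ∘ luniti munit
}.

Record is_right_comodule_algebra (A : C) (mulA : A ⊗ A ~> A)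
    (unitA : munit ~> A) (rho : A ~> A ⊗ H) : Prop := {
  rcomodalg_alg : is_algebra mulA unitA;
  rcomodalg_comod : is_right_comodule rho;
  rcomodalg_mul : rho ∘ mulA
    = (mulA ⊗ mulH H) ∘ midbraid A H A H ∘ (rho ⊗ rho);
  rcomodalg_unit : rho ∘ unitA = (unitA ⊗ unitH H) ∘ luniti munit
}.

Record is_bicomodule_algebra (A : C) (mulA : A ⊗ A ~> A)
    (unitA : munit ~> A) (lam : A ~> H ⊗ A) (rho : A ~> A ⊗ H) : Prop := {
  bicomodalg_l : is_left_comodule_algebra mulA unitA lam;
  bicomodalg_r : is_right_comodule_algebra mulA unitA rho;
  bicomodalg_lr : (idm H ⊗ rho) ∘ lam = assoc H A H ∘ (lam ⊗ idm H) ∘ rho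
}.

Record is_bicomodule_algebra_morphism
    (A : C) (mulA : A ⊗ A ~> A) (unitA : munit ~> A)
    (lamA : A ~> H ⊗ A) (rhoA : A ~> A ⊗ H)
    (B : C) (mulB : B ⊗ B ~> B) (unitB : munit ~> B)
    (lamB : B ~> H ⊗ B) (rhoB : B ~> B ⊗ H) (f : A ~> B) : Prop := {
  bicomodmor_alg : is_algebra_morphism mulA unitA mulB unitB f;
  bicomodmor_l : is_left_colinear lamA lamB f;
  bicomodmor_r : is_right_colinear rhoA rhoB f
}.

Definition is_bicomodule_algebra_iso
    (A : C) (mulA : A ⊗ A ~> A) (unitA : munit ~> A)
    (lamA : A ~> H ⊗ A) (rhoA : A ~> A ⊗ H)
    (B : C) (mulB : B ⊗ B ~> B) (unitB : munit ~> B)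
    (lamB : B ~> H ⊗ B) (rhoB : B ~> B ⊗ H) (f : A ~> B) : Prop :=
  is_bicomodule_algebra_morphism mulA unitA lamA rhoA mulB unitB lamB rhoB f /\
  exists g : B ~> A,
    [/\ is_bicomodule_algebra_morphism
          mulB unitB lamB rhoB mulA unitA lamA rhoA g,
        g ∘ f = idm A & f ∘ g = idm B].

Record is_yetter_drinfeld (M : C) (mu : H ⊗ M ~> M) (lam : M ~> H ⊗ M)
    : Prop := {
  yd_mod : is_module mu;
  yd_comod : is_left_comodule lam;
  yd_compat :
    (mulH H ⊗ mu) ∘ midbraid H H H M ∘ (comulH H ⊗ lam)
    = (mulH H ⊗ idm M) ∘ associ H H M ∘ (idm H ⊗ braid M H) ∘ assoc H M H
      ∘ (lam ⊗ idm H) ∘ (mu ⊗ idm H)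
      ∘ associ H M H ∘ (idm H ⊗ braid H M) ∘ assoc H H M ∘ (comulH H ⊗ idm M)
}.

Record is_yetter_drinfeld_morphism
    (M : C) (muM : H ⊗ M ~> M) (lamM : M ~> H ⊗ M)
    (N : C) (muN : H ⊗ N ~> N) (lamN : N ~> H ⊗ N) (f : M ~> N) : Prop := {
  ydmor_linear : is_linear muM muN f;
  ydmor_colinear : is_left_colinear lamM lamN f
}.

Definition diag_action (M N : C) (muM : H ⊗ M ~> M) (muN : H ⊗ N ~> N) :
    H ⊗ (M ⊗ N) ~> M ⊗ N :=
  (muM ⊗ muN) ∘ midbraid H H M N ∘ (comulH H ⊗ idm (M ⊗ N)).

Definition diag_coaction (M N : C) (lamM : M ~> H ⊗ M) (lamN : N ~> H ⊗ N) :
    M ⊗ N ~> H ⊗ (M ⊗ N) :=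
  (mulH H ⊗ idm (M ⊗ N)) ∘ midbraid H M H N ∘ (lamM ⊗ lamN).

Definition unit_action : H ⊗ munit ~> munit := counitH H ∘ runit H.

Definition unit_coaction : munit ~> H ⊗ munit :=
  (unitH H ⊗ idm munit) ∘ luniti munit.

(* An algebra in the monoidal category of Yetter-Drinfeld modules, whose
   associativity and unit constraints are those of C. *)
Record is_yetter_drinfeld_algebra (A : C) (mulA : A ⊗ A ~> A)
    (unitA : munit ~> A) (mu : H ⊗ A ~> A) (lam : A ~> H ⊗ A) : Prop := {
  ydalg_yd : is_yetter_drinfeld mu lam;
  ydalg_alg : is_algebra mulA unitA;
  ydalg_mul : is_yetter_drinfeld_morphism
    (diag_action mu mu) (diag_coaction lam lam) mu lam mulA;
  ydalg_unit : is_yetter_drinfeld_morphism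
    unit_action unit_coaction mu lam unitA
}.

Lemma yetter_drinfeld_algebraE (A : C) (mulA : A ⊗ A ~> A)
    (unitA : munit ~> A) (mu : H ⊗ A ~> A) (lam : A ~> H ⊗ A) :
  is_yetter_drinfeld_algebra mulA unitA mu lam <->
  [/\ is_yetter_drinfeld mu lam, is_module_algebra mulA unitA mu
    & is_left_comodule_algebra mulA unitA lam].
Proof.
have colE : (idm H ⊗ mulA) ∘ diag_coaction lam lam
          = (mulH H ⊗ mulA) ∘ midbraid H A H A ∘ (lam ⊗ lam).
  by rewrite /diag_coaction !compA -tensmM comp1m compm1.
have col1 : (idm H ⊗ unitA) ∘ unit_coaction
          = (unitH H ⊗ unitA) ∘ luniti munit.
  by rewrite /unit_coaction compA -tensmM comp1m compm1.
split.
- case=> yd alg [linM colM] [lin1 col1']; split=> //; split=> //.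
  + by case: yd.
  + by rewrite -linM /diag_action !compA.
  + by rewrite -lin1 /unit_action compA.
  + by case: yd.
  + by rewrite colM colE.
  + by rewrite col1' col1.
- case=> yd [alg _ mM m1] [_ _ cM c1]; split=> //; split.
  + by rewrite /is_linear mM /diag_action !compA.
  + by rewrite /is_left_colinear cM colE.
  + by rewrite /is_linear m1 /unit_action compA.
  + by rewrite /is_left_colinear c1 col1.
Qed.

Section SmashProduct.
Variable A : C.

Definition smash_mul (mulA : A ⊗ A ~> A) (mu : H ⊗ A ~> A) :
    (A ⊗ H) ⊗ (A ⊗ H) ~> A ⊗ H :=
  (mulA ⊗ mulH H)
  ∘ ((idm A ⊗ mu) ⊗ idm (H ⊗ H))
  ∘ (assoc A H A ⊗ idm (H ⊗ H))
  ∘ midbraid (A ⊗ H) H A H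
  ∘ (associ A H H ⊗ idm (A ⊗ H))
  ∘ ((idm A ⊗ comulH H) ⊗ idm (A ⊗ H)).

Definition smash_unit (unitA : munit ~> A) : munit ~> A ⊗ H :=
  (unitA ⊗ unitH H) ∘ luniti munit.

Definition smash_lcoaction (lam : A ~> H ⊗ A) : A ⊗ H ~> H ⊗ (A ⊗ H) :=
  (mulH H ⊗ idm (A ⊗ H)) ∘ midbraid H A H H ∘ (lam ⊗ comulH H).

Definition smash_rcoaction : A ⊗ H ~> (A ⊗ H) ⊗ H :=
  associ A H H ∘ (idm A ⊗ comulH H).

End SmashProduct.

Definition coinv_proj (B : C) (mulB : B ⊗ B ~> B) (rho : B ~> B ⊗ H)
    (v : H ~> B) : B ~> B :=
  mulB ∘ (idm B ⊗ (v ∘ antipode H)) ∘ rho.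

Definition adjoint_action (B : C) (mulB : B ⊗ B ~> B) (v : H ~> B) :
    H ⊗ B ~> B :=
  mulB ∘ (mulB ⊗ idm B) ∘ associ B B B
  ∘ (v ⊗ (idm B ⊗ (v ∘ antipode H)))
  ∘ (idm H ⊗ braid H B) ∘ assoc H H B ∘ (comulH H ⊗ idm B).

End HopfNotions.

Arguments smash_rcoaction {C} H A%_ob.

(* Main.v *)
Require Import Defs.
From mathcomp Require Import ssreflect.

(* In Sweedler notation, E(b) = b_0 v(S(b_1)), and b = E(b_0) v(b_1) because S is
   a convolution inverse of the identity.  Substituting the latter into
   rho(E(b)) = rho(b_0) rho(v(S(b_1))) gives rho(E(b)) = E(b) ⊗ 1, so E is the
   projection onto the coinvariants; moreover E(a b) = a E(b) for coinvariant a,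
   and E(b v(h)) = E(b) eps(h).  For coinvariant b the adjoint action is
   h · b = E(v(h) b), and applying b = E(b_0) v(b_1) to v(h) b yields the
   commutation rule v(h) b = (h_1 · b) v(h_2).  Everything else follows from this
   rule: E applied to v(h) a b gives the module algebra axiom, H ⊗ E applied to
   lam(v(h) b) gives the Yetter-Drinfeld condition, and the rule itself says that
   omega is multiplicative.  Its inverse is (p ⊗ H) rho, along which the
   bicomodule algebra structure of B is transported to the smash product.
   The braiding is only ever used through naturality and phi_{I,X}. *)

Set Implicit Arguments.
Unset Strict Implicit.
Unset Printing Implicit Defensive.

Local Open Scope hom_scope.

(** * Rewriting and cancellation in a category *)

Section Composition.
Variable C : Category.

(** In a left-associated composite [k ∘ g ∘ f] the factor [g ∘ f] is not a subterm, so an equation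
    for it is restated behind an arbitrary [k]. *)
Lemma comp_eql (X Y Z : C) (g : Y ~> Z) (f : X ~> Y) (h : X ~> Z) :
  g ∘ f = h -> forall (W : C) (k : Z ~> W), k ∘ g ∘ f = k ∘ h.
Proof. by move=> <- W k; rewrite compA. Qed.

Lemma comp_eql2 (X Y Z T : C) (h : Z ~> T) (g : Y ~> Z) (f : X ~> Y) (d : X ~> T) :
  h ∘ g ∘ f = d -> forall (W : C) (k : T ~> W), k ∘ h ∘ g ∘ f = k ∘ d.
Proof. by move=> <- W k; rewrite !compA. Qed.

Lemma split_mono (X Y Z : C) (s : Y ~> Z) (r : Z ~> Y) (f g : X ~> Y) :
  r ∘ s = idm Y -> s ∘ f = s ∘ g -> f = g.
Proof. by move=> rs /(f_equal (comp r)); rewrite !compA rs !comp1m. Qed.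

Lemma split_epi (X Y Z : C) (r : Z ~> X) (s : X ~> Z) (f g : X ~> Y) :
  r ∘ s = idm X -> f ∘ r = g ∘ r -> f = g.
Proof. by move=> rs /(f_equal (fun h => h ∘ s)); rewrite -!compA rs !compm1. Qed.

End Composition.

(** * Coherence of the associativity and unit constraints *)

Section Coherence.
Variable C : MonoidalCategory.

Lemma tens_split (X X' Y Y' : C) (f : X ~> X') (g : Y ~> Y') :
  f ⊗ g = (f ⊗ idm Y') ∘ (idm X ⊗ g).
Proof. by rewrite -tensmM comp1m compm1. Qed.

Lemma tens_split' (X X' Y Y' : C) (f : X ~> X') (g : Y ~> Y') :
  f ⊗ g = (idm X' ⊗ g) ∘ (f ⊗ idm Y).
Proof. by rewrite -tensmM comp1m compm1. Qed.

Lemma tens_compl (X Y Z W : C) (g : Y ~> Z) (f : X ~> Y) :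
  idm W ⊗ (g ∘ f) = (idm W ⊗ g) ∘ (idm W ⊗ f).
Proof. by rewrite -tensmM comp1m. Qed.

Lemma tens_compr (X Y Z W : C) (g : Y ~> Z) (f : X ~> Y) :
  (g ∘ f) ⊗ idm W = (g ⊗ idm W) ∘ (f ⊗ idm W).
Proof. by rewrite -tensmM comp1m. Qed.

Lemma tens_split_mono (X X' Y Y' : C) (s : X ~> Y) (r : Y ~> X)
    (s' : X' ~> Y') (r' : Y' ~> X') :
  r ∘ s = idm X -> r' ∘ s' = idm X' -> (r ⊗ r') ∘ (s ⊗ s') = idm (X ⊗ X').
Proof. by move=> e e'; rewrite -tensmM e e' tensm1. Qed.

Lemma associ_nat (X X' Y Y' Z Z' : C) (f : X ~> X') (g : Y ~> Y') (h : Z ~> Z') :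
  associ X' Y' Z' ∘ (f ⊗ (g ⊗ h)) = ((f ⊗ g) ⊗ h) ∘ associ X Y Z.
Proof.
apply: (split_mono (assocK _ _ _)); rewrite !compA associK comp1m.
by rewrite assoc_nat -compA associK compm1.
Qed.

Lemma runiti_nat (X Y : C) (f : X ~> Y) :
  runiti Y ∘ f = (f ⊗ idm munit) ∘ runiti X.
Proof.
apply: (split_mono (runitK _)); rewrite !compA runitiK comp1m.
by rewrite runit_nat -compA runitiK compm1.
Qed.

Lemma luniti_nat (X Y : C) (f : X ~> Y) :
  luniti Y ∘ f = (idm munit ⊗ f) ∘ luniti X.
Proof.
apply: (split_mono (lunitK _)); rewrite !compA lunitiK comp1m.
by rewrite lunit_nat -compA lunitiK compm1.
Qed.

Lemma tens_unitl_inj (X Y : C) (f g : X ~> Y) :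
  idm munit ⊗ f = idm munit ⊗ g -> f = g.
Proof.
by move=> e; apply: (split_epi (lunitiK X)); rewrite -!lunit_nat e.
Qed.

Lemma tens_unitr_inj (X Y : C) (f g : X ~> Y) :
  f ⊗ idm munit = g ⊗ idm munit -> f = g.
Proof.
by move=> e; apply: (split_epi (runitiK X)); rewrite -!runit_nat e.
Qed.

(** Kelly's argument: tensoring with the unit object is faithful, and after doing so the claim
    follows from the pentagon at I, I, X, Y, the triangle and naturality. *)
Lemma lunit_assoc (X Y : C) :
  lunit (X ⊗ Y) ∘ assoc munit X Y = lunit X ⊗ idm Y.
Proof.
apply: tens_unitl_inj; rewrite tens_compl.
have e1 : (assoc munit munit X ⊗ idm Y) ∘ (associ munit munit X ⊗ idm Y) = idm _.
  by rewrite -tens_compr associK tensm1.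
apply: (split_epi (associK munit (munit ⊗ X) Y)); apply: (split_epi e1).
rewrite -!compA (compA (idm munit ⊗ assoc _ _ _)).
rewrite -pentagon compA triangle -tensm1 -assoc_nat -triangle.
by rewrite tens_compr compA assoc_nat -compA.
Qed.

Lemma runit_assoc (X Y : C) :
  (idm X ⊗ runit Y) ∘ assoc X Y munit = runit (X ⊗ Y).
Proof.
apply: tens_unitr_inj; apply: (split_mono (assocK X Y munit)).
rewrite -triangle tens_compr !compA assoc_nat -(tensm1 X Y) assoc_nat.
rewrite -triangle tens_compl.
by rewrite -[RHS]compA pentagon !compA.
Qed.

Lemma lunit_runit_munit : lunit munit = runit munit :> (_ ~> @munit C).
Proof.
apply: tens_unitr_inj; rewrite -lunit_assoc -triangle; congr (_ ∘ _).
by apply: (split_mono (lunitK _)); rewrite lunit_nat.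
Qed.

Lemma luniti_runiti_munit : luniti munit = runiti munit :> (@munit C ~> _).
Proof.
by apply: (split_mono (runitK _)); rewrite -{1}lunit_runit_munit lunitiK runitiK.
Qed.

Lemma runiti_assoc (X Y : C) :
  associ X Y munit ∘ (idm X ⊗ runiti Y) = runiti (X ⊗ Y).
Proof.
apply: (split_mono (runitK _)); rewrite runitiK -runit_assoc -!compA.
by rewrite (compA (assoc _ _ _)) associK comp1m -tens_compl runitiK tensm1.
Qed.

Lemma triangle_inv (X Y : C) :
  assoc X munit Y ∘ (runiti X ⊗ idm Y) = idm X ⊗ luniti Y.
Proof.
have e : (idm X ⊗ luniti Y) ∘ (idm X ⊗ lunit Y) = idm _.
  by rewrite -tens_compl lunitK tensm1.
apply: (split_mono e).
by rewrite compA triangle -tens_compr runitiK -tens_compl lunitiK !tensm1.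
Qed.

(** Two pentagons compare whiskering by [X ⊗ W] with whiskering by [W] and then by [X]; with a braid
    as [b] this yields [lmidbraid_assoc]. *)
Lemma whisker_assoc (X W Y T Z T' : C) (b : Y ⊗ T ~> Z ⊗ T') :
  associ (X ⊗ W) Z T' ∘ (idm (X ⊗ W) ⊗ b) ∘ assoc (X ⊗ W) Y T
  = (associ X W Z ⊗ idm T') ∘ associ X (W ⊗ Z) T'
    ∘ (idm X ⊗ (associ W Z T' ∘ (idm W ⊗ b) ∘ assoc W Y T))
    ∘ assoc X (W ⊗ Y) T ∘ (assoc X W Y ⊗ idm T).
Proof.
apply: (split_mono (assocK _ _ _)).
apply: (split_mono (assocK _ _ _)).
rewrite !compA (comp_eql (associK (X ⊗ W) Z T')) compm1.
rewrite pentagon.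
rewrite (comp_eql (tens_split_mono (associK X W Z) (comp1m (idm T')))) compm1.
rewrite (comp_eql (associK _ _ _)) compm1 -!tens_compl !compA associK comp1m.
rewrite tens_compl -!compA (compA (idm X ⊗ assoc W Y T)) -pentagon !compA.
by rewrite -(tensm1 X W) assoc_nat.
Qed.

End Coherence.

(** * Braids in the middle and at the end of a tensor product *)

Section BraidedCoherence.
Variable C : BraidedCategory.

(** The hexagon at I, I, X, followed by [runit], has [braid munit X] as an outer factor on both
    sides; cancelling it leaves the claim whiskered by I. *)
Lemma braid_munit (X : C) : runit X ∘ braid munit X = lunit X.
Proof.
apply: tens_unitl_inj; apply: (split_mono (braidK _ _)).
have := f_equal (comp (runit (X ⊗ munit))) (hexagon_l munit munit X).
rewrite !compA runit_nat -(compA (braid munit X)) -(runit_assoc munit X).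
rewrite -(compA (idm munit ⊗ runit X)) associK compm1.
rewrite -(runit_assoc X munit) -(compA (idm X ⊗ runit munit)) associK compm1.
rewrite -braid_nat -(triangle munit X) !compA.
rewrite (comp_eql (associK _ _ _)) compm1 -!compA -tens_compl.
by move=> e; apply: eq_sym; exact: e.
Qed.

(* [endbraid] and [lmidbraid] are locked because [rewrite compA] would otherwise
   unfold them and reassociate the composites inside. *)
Definition endbraid (W X Y : C) : (W ⊗ X) ⊗ Y ~> (W ⊗ Y) ⊗ X :=
  locked (associ W Y X ∘ (idm W ⊗ braid X Y) ∘ assoc W X Y).

Lemma endbraidE (W X Y : C) :
  associ W Y X ∘ (idm W ⊗ braid X Y) ∘ assoc W X Y = endbraid W X Y.
Proof. by rewrite /endbraid -lock. Qed.

Definition lmidbraid (W X Y Z : C) : (W ⊗ X) ⊗ (Y ⊗ Z) ~> (W ⊗ Y) ⊗ (X ⊗ Z) :=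
  locked (midbraid W X Y Z).

Lemma midbraidE (W X Y Z : C) : midbraid W X Y Z = lmidbraid W X Y Z.
Proof. by rewrite /lmidbraid -lock. Qed.

Lemma endbraid_nat (W W' X X' Y Y' : C) (f : W ~> W') (g : X ~> X') (h : Y ~> Y') :
  endbraid W' X' Y' ∘ ((f ⊗ g) ⊗ h) = ((f ⊗ h) ⊗ g) ∘ endbraid W X Y.
Proof.
rewrite -!endbraidE -compA assoc_nat !compA -associ_nat; congr (_ ∘ _).
by rewrite -!compA -!tensmM comp1m compm1 braid_nat.
Qed.

Lemma lmidbraid_nat (W W' X X' Y Y' Z Z' : C)
    (f : W ~> W') (g : X ~> X') (h : Y ~> Y') (k : Z ~> Z') :
  lmidbraid W' X' Y' Z' ∘ ((f ⊗ g) ⊗ (h ⊗ k))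
  = ((f ⊗ h) ⊗ (g ⊗ k)) ∘ lmidbraid W X Y Z.
Proof.
rewrite -!midbraidE /midbraid -compA assoc_nat !compA -associ_nat; congr (_ ∘ _).
rewrite -!compA -!tensmM comp1m compm1; congr (_ ∘ (_ ⊗ _)).
rewrite -!compA associ_nat !compA -assoc_nat; congr (_ ∘ _).
by rewrite -!compA -!tensmM comp1m compm1 braid_nat.
Qed.

(** The last factor is a spectator. This links the middle braid of module algebras and smash
    products to the [endbraid] inside [exch]. *)
Lemma lmidbraid_endbraid (W X Y Z : C) :
  lmidbraid W X Y Z
  = assoc (W ⊗ Y) X Z ∘ (endbraid W X Y ⊗ idm Z) ∘ associ (W ⊗ X) Y Z.
Proof.
apply: (split_mono (assocK _ _ _)); apply: (split_epi (associK _ _ _)).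
rewrite -!midbraidE -!endbraidE /midbraid !compA associK comp1m.
rewrite (comp_eql (assocK _ _ _)) compm1 -compA pentagon !compA -tens_compl.
rewrite (comp_eql (assocK _ _ _)) compm1 pentagon !tens_compr !compA.
rewrite (comp_eql (tens_split_mono (associK W Y X) (comp1m (idm Z)))) compm1.
by rewrite tens_compl -(compA (idm W ⊗ assoc Y X Z)) -assoc_nat !compA.
Qed.

Lemma lmidbraid_munitl (X B H : C) :
  (idm (X ⊗ B) ⊗ lunit H) ∘ lmidbraid X munit B H ∘ (runiti X ⊗ idm (B ⊗ H))
  = associ X B H.
Proof.
rewrite -!midbraidE /midbraid !compA -tensm1 -associ_nat -(compA (associ X B H)) -tens_compl.
rewrite !compA triangle -tens_compr braid_munit -lunit_assoc.
rewrite (comp_eql (associK _ _ _)) compm1.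
rewrite -!compA triangle_inv -tens_compl lunitiK tensm1.
by rewrite compm1.
Qed.

Lemma lmidbraid_munitr (W H B : C) :
  (idm (W ⊗ B) ⊗ runit H) ∘ lmidbraid W H B munit ∘ (idm (W ⊗ H) ⊗ runiti B)
  = endbraid W H B.
Proof.
rewrite -midbraidE -endbraidE /midbraid !compA -tensm1 -associ_nat -(compA (associ W B H)) -tens_compl.
rewrite !compA runit_assoc runit_nat -(compA (braid H B)).
rewrite -runit_assoc (comp_eql (associK _ _ _)) compm1.
rewrite -(tensm1 W H) -(compA _ (assoc _ _ _)) assoc_nat !compA.
rewrite -(compA (associ _ _ _)) -tens_compl -(compA (braid H B)) -tens_compl.
by rewrite runitiK tensm1 compm1.
Qed.

Lemma lmidbraid_assoc (X W Y Z T : C) :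
  lmidbraid (X ⊗ W) Y Z T ∘ (associ X W Y ⊗ idm (Z ⊗ T))
  = (associ X W Z ⊗ idm (Y ⊗ T)) ∘ associ X (W ⊗ Z) (Y ⊗ T)
    ∘ (idm X ⊗ lmidbraid W Y Z T) ∘ assoc X (W ⊗ Y) (Z ⊗ T).
Proof.
rewrite -!midbraidE /midbraid whisker_assoc.
rewrite (comp_eql (tens_split_mono (associK X W Y) (comp1m (idm (Z ⊗ T))))).
by rewrite compm1.
Qed.

End BraidedCoherence.

(** * Algebra laws on generalised elements *)

Section Algebra.
Variables (C : MonoidalCategory) (B : C) (mulB : B ⊗ B ~> B) (unitB : munit ~> B).
Hypothesis algB : is_algebra mulB unitB.

Lemma mul_assoc (X Y Z : C) (x : X ~> B) (y : Y ~> B) (z : Z ~> B) :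
  mulB ∘ ((mulB ∘ (x ⊗ y)) ⊗ z) = mulB ∘ (x ⊗ (mulB ∘ (y ⊗ z))) ∘ assoc X Y Z.
Proof.
rewrite -{1}[z]comp1m tensmM compA (algA algB) -!compA assoc_nat !compA.
by rewrite -(compA mulB) -tensmM comp1m.
Qed.

Lemma mul_associ (X Y Z : C) (x : X ~> B) (y : Y ~> B) (z : Z ~> B) :
  mulB ∘ (x ⊗ (mulB ∘ (y ⊗ z))) = mulB ∘ ((mulB ∘ (x ⊗ y)) ⊗ z) ∘ associ X Y Z.
Proof. by rewrite mul_assoc (comp_eql (associK _ _ _)) compm1. Qed.

Lemma mul_unitr (X : C) (x : X ~> B) : mulB ∘ (x ⊗ unitB) = x ∘ runit X.
Proof. by rewrite tens_split' compA (algm1 algB) runit_nat. Qed.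

Lemma mul_unitl (X : C) (x : X ~> B) : mulB ∘ (unitB ⊗ x) = x ∘ lunit X.
Proof. by rewrite tens_split compA (alg1m algB) lunit_nat. Qed.

Lemma is_algebra_reflect (A : C) (mulA : A ⊗ A ~> A) (unitA : munit ~> A)
    (f : A ~> B) (r : B ~> A) :
  r ∘ f = idm A -> is_algebra_morphism mulA unitA mulB unitB f ->
  is_algebra mulA unitA.
Proof.
move=> rf [fM f1]; split; apply: (split_mono rf); rewrite !compA fM.
- by rewrite -!compA (compA (f ⊗ f)) -!tensmM !compm1 fM mul_assoc compA.
- by rewrite -compA -tensmM f1 compm1 mul_unitl.
- by rewrite -compA -tensmM f1 compm1 mul_unitr.
Qed.

End Algebra.

(** * Pulling structure back along a split monomorphism *)

Section Reflection.
Variables (C : BraidedCategory) (H : HopfAlgebra C).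
Variables (A : C) (mulA : A ⊗ A ~> A) (unitA : munit ~> A)
  (lamA : A ~> H ⊗ A) (rhoA : A ~> A ⊗ H).
Variables (B : C) (mulB : B ⊗ B ~> B) (unitB : munit ~> B)
  (lamB : B ~> H ⊗ B) (rhoB : B ~> B ⊗ H).
Variables (f : A ~> B) (r : B ~> A).
Hypothesis rf : r ∘ f = idm A.

(** Tensoring [f] with identities keeps it split, so each comodule law may be tested in [B]; the
    other reflection lemmas work the same way. *)
Lemma is_left_comodule_reflect :
  is_left_comodule lamB -> is_left_colinear lamA lamB f -> is_left_comodule lamA.
Proof.
move=> [lA l1] fl; split.
- have rHH := tens_split_mono (comp1m (idm H)) (tens_split_mono (comp1m (idm H)) rf).
  apply: (split_mono rHH).
  rewrite !compA -assoc_nat tensm1 -(compA (assoc _ _ _)) -tensmM comp1m compm1.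
  rewrite -tens_compl -fl tens_compl -[RHS]compA -fl compA -lA.
  by rewrite -!compA fl (compA (comulH H ⊗ _)) -tensmM comp1m compm1.
- apply: (split_mono (tens_split_mono (comp1m (idm munit)) rf)).
  rewrite compA -tensmM comp1m compm1 -luniti_nat -l1 -compA fl compA.
  by rewrite -tensmM comp1m compm1.
Qed.

Lemma is_right_comodule_reflect :
  is_right_comodule rhoB -> is_right_colinear rhoA rhoB f -> is_right_comodule rhoA.
Proof.
move=> [lA l1] fl; split.
- have rHH := tens_split_mono rf (tens_split_mono (comp1m (idm H)) (comp1m (idm H))).
  apply: (split_mono rHH).
  rewrite !compA -assoc_nat -(compA (assoc _ _ _)) -tens_compr -fl.
  rewrite tens_compr -!compA -fl !compA lA tensm1 -tensmM comp1m compm1.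
  by rewrite -compA fl compA -tensmM comp1m compm1.
- apply: (split_mono (tens_split_mono rf (comp1m (idm munit)))).
  rewrite compA -tensmM comp1m compm1 -runiti_nat -l1 -compA fl compA.
  by rewrite -tensmM comp1m compm1.
Qed.

Hypothesis fA : is_algebra_morphism mulA unitA mulB unitB f.

Lemma is_left_comodule_algebra_reflect :
  is_left_comodule_algebra mulB unitB lamB -> is_left_colinear lamA lamB f ->
  is_left_comodule_algebra mulA unitA lamA.
Proof.
move=> [algB lC lM l1] fl; case: (fA) => fM f1; rewrite midbraidE in lM.
have rH := tens_split_mono (comp1m (idm H)) rf.
split; first exact: (is_algebra_reflect algB rf fA).
- exact: is_left_comodule_reflect fl.
- apply: (split_mono rH); rewrite midbraidE !compA -fl -compA fM compA lM.
  rewrite -tensmM comp1m fM -(compA _ (lamB ⊗ lamB)) -tensmM fl tensmM.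
rewrite !compA -(compA (mulH H ⊗ mulB)) lmidbraid_nat !compA -tensmM.
  by rewrite tensm1 compm1.
- apply: (split_mono rH); rewrite !compA -fl -compA f1 l1.
  by rewrite -tensmM comp1m f1.
Qed.

Lemma is_right_comodule_algebra_reflect :
  is_right_comodule_algebra mulB unitB rhoB -> is_right_colinear rhoA rhoB f ->
  is_right_comodule_algebra mulA unitA rhoA.
Proof.
move=> [algB lC lM l1] fl; case: (fA) => fM f1; rewrite midbraidE in lM.
have rH := tens_split_mono rf (comp1m (idm H)).
split; first exact: (is_algebra_reflect algB rf fA).
- exact: is_right_comodule_reflect fl.
- apply: (split_mono rH); rewrite midbraidE !compA -fl -compA fM compA lM.
  rewrite -tensmM comp1m fM -(compA _ (rhoB ⊗ rhoB)) -tensmM fl tensmM.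
  rewrite !compA -(compA (mulB ⊗ mulH H)) lmidbraid_nat !compA -tensmM.
  by rewrite tensm1 compm1.
- apply: (split_mono rH); rewrite !compA -fl -compA f1 l1.
  by rewrite -tensmM comp1m f1.
Qed.

Lemma is_bicomodule_algebra_reflect :
  is_bicomodule_algebra mulB unitB lamB rhoB ->
  is_left_colinear lamA lamB f -> is_right_colinear rhoA rhoB f ->
  is_bicomodule_algebra mulA unitA lamA rhoA.
Proof.
move=> [lB rB lr] fl fr; split.
- exact: is_left_comodule_algebra_reflect.
- exact: is_right_comodule_algebra_reflect.
- have rH := tens_split_mono (comp1m (idm H)) (tens_split_mono rf (comp1m (idm H))).
  apply: (split_mono rH).
  rewrite compA -tens_compl -fr tens_compl -compA -fl compA lr.
  rewrite !compA -assoc_nat -[in RHS](compA (assoc _ _ _)) -tens_compr -fl.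
  by rewrite tens_compr -!compA fr.
Qed.

Lemma is_bicomodule_algebra_isoI :
  is_left_colinear lamA lamB f -> is_right_colinear rhoA rhoB f ->
  f ∘ r = idm B ->
  is_bicomodule_algebra_iso mulA unitA lamA rhoA mulB unitB lamB rhoB f.
Proof.
move=> fl fr fr1; case: (fA) => fM f1; split; first by split.
exists r; split=> //; split; first split.
- apply: (split_mono rf); rewrite !compA fr1 comp1m fM.
  by rewrite -compA -tensmM fr1 tensm1 compm1.
- by rewrite -f1 compA rf comp1m.
- apply: (split_mono (tens_split_mono (comp1m (idm H)) rf)).
  rewrite compA -fl -compA fr1 compm1 compA -tens_compl fr1 tensm1.
  by rewrite comp1m.
- apply: (split_mono (tens_split_mono rf (comp1m (idm H)))).
  rewrite compA -fr -compA fr1 compm1 compA -tens_compr fr1 tensm1.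
  by rewrite comp1m.
Qed.

End Reflection.

(** * The projection [E] onto the coinvariants *)

Section Coinvariants.
Variables (C : BraidedCategory) (H : HopfAlgebra C).
Variables (B : C) (mulB : B ⊗ B ~> B) (unitB : munit ~> B)
  (lam : B ~> H ⊗ B) (rho : B ~> B ⊗ H) (v : H ~> B).
Hypothesis hB : is_bicomodule_algebra mulB unitB lam rho.
Hypothesis hv : is_bicomodule_algebra_morphism
  (mulH H) (unitH H) (comulH H) (comulH H) mulB unitB lam rho v.

Let algB : is_algebra mulB unitB := lcomodalg_alg (bicomodalg_l hB).
Let rhoC : is_right_comodule rho := rcomodalg_comod (bicomodalg_r hB).
Let vM : v ∘ mulH H = mulB ∘ (v ⊗ v) := morM (bicomodmor_alg hv).
Let v1 : v ∘ unitH H = unitB := mor1 (bicomodmor_alg hv).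
Let vl : lam ∘ v = (idm H ⊗ v) ∘ comulH H := bicomodmor_l hv.
Let vr : rho ∘ v = (v ⊗ idm H) ∘ comulH H := bicomodmor_r hv.

(* A variable rather than a definition, for the same reason as [endbraid]. *)
Variable E : B ~> B.
Hypothesis coinv_projE : E = coinv_proj mulB rho v.

Lemma rho_mul : rho ∘ mulB = (mulB ⊗ mulH H) ∘ lmidbraid B H B H ∘ (rho ⊗ rho).
Proof. by rewrite (rcomodalg_mul (bicomodalg_r hB)) midbraidE. Qed.

Lemma lam_mul : lam ∘ mulB = (mulH H ⊗ mulB) ∘ lmidbraid H B H B ∘ (lam ⊗ lam).
Proof. by rewrite (lcomodalg_mul (bicomodalg_l hB)) midbraidE. Qed.

(** Endomorphisms of [B] form a right module over the convolution algebra of morphisms [H ~> B], via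
    f * g = [mulB ∘ (f ⊗ g) ∘ rho]. This is its associativity, and [conv_unit] its unit law. *)
Lemma conv_assoc (f : B ~> B) (g h : H ~> B) :
  mulB ∘ ((mulB ∘ (f ⊗ g) ∘ rho) ⊗ h) ∘ rho
  = mulB ∘ (f ⊗ (mulB ∘ (g ⊗ h) ∘ comulH H)) ∘ rho.
Proof.
rewrite -[h in LHS]compm1 tensmM compA (mul_assoc algB) -!compA.
rewrite (compA (assoc _ _ _)) (rcomodA rhoC).
by rewrite (compA (f ⊗ _)) -tensmM compm1 !compA.
Qed.

Lemma conv_unit (f : B ~> B) : mulB ∘ (f ⊗ (unitB ∘ counitH H)) ∘ rho = f.
Proof.
rewrite -[f in LHS]compm1 tensmM -!compA (rcomod1 rhoC) compA (mul_unitr algB).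
by rewrite -compA runitiK compm1.
Qed.

Lemma v_antipode_r : mulB ∘ (v ⊗ (v ∘ antipode H)) ∘ comulH H = unitB ∘ counitH H.
Proof.
by rewrite -{1}[v]compm1 tensmM compA -vM -!compA (compA (mulH H)) antipode_r compA v1.
Qed.

Lemma v_antipode_l : mulB ∘ ((v ∘ antipode H) ⊗ v) ∘ comulH H = unitB ∘ counitH H.
Proof.
by rewrite -{2}[v]compm1 tensmM compA -vM -!compA (compA (mulH H)) antipode_l compA v1.
Qed.

(** Evaluate v(S(h_1)) v(h_2) = eps(h) at h = 1 and use v(1) = 1. *)
Lemma v_antipode_unit : v ∘ antipode H ∘ unitH H = unitB.
Proof.
have := f_equal (fun f => f ∘ unitH H) v_antipode_l.
rewrite -(compA unitB) counit_unit compm1 -compA comul_unit !compA => <-.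
rewrite -(compA mulB) -tensmM v1 (mul_unitr algB) luniti_runiti_munit.
by rewrite -[RHS]compA runitiK compm1.
Qed.

Lemma coinv_proj_v : E ∘ v = unitB ∘ counitH H.
Proof.
rewrite coinv_projE /coinv_proj -compA vr compA -(compA mulB) -tensmM comp1m compm1.
exact: v_antipode_r.
Qed.

Lemma coinv_proj_unit : E ∘ unitB = unitB.
Proof. by rewrite -v1 compA coinv_proj_v -compA counit_unit compm1 v1. Qed.

Lemma coinv_proj_conv : mulB ∘ (E ⊗ v) ∘ rho = idm B.
Proof. by rewrite coinv_projE /coinv_proj conv_assoc v_antipode_l conv_unit. Qed.

(** The product of the braided tensor algebra [B ⊗ H] is left linear for [B] acting on the first
    leg; it serves to pull E(b_0) out of a product. *)
Lemma mul_tensor_linear :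
  (mulB ⊗ mulH H) ∘ lmidbraid B H B H ∘ ((mulB ⊗ idm H) ⊗ idm (B ⊗ H))
    ∘ (associ B B H ⊗ idm (B ⊗ H))
  = (mulB ⊗ idm H) ∘ associ B B H
    ∘ (idm B ⊗ ((mulB ⊗ mulH H) ∘ lmidbraid B H B H)) ∘ assoc B (B ⊗ H) (B ⊗ H).
Proof.
rewrite -(tensm1 B H) -(compA (mulB ⊗ mulH H)) lmidbraid_nat !tensm1 !compA.
rewrite -(compA _ (lmidbraid _ _ _ _)) lmidbraid_assoc !compA -!tensmM !compm1.
rewrite (algA algB) (comp_eql (associK _ _ _)) compm1 tens_compl !compA.
by rewrite -(compA (mulB ⊗ idm H)) associ_nat !compA -tensmM comp1m.
Qed.

Lemma rho_coassoc_inv : associ B H H ∘ (idm B ⊗ comulH H) ∘ rho = (rho ⊗ idm H) ∘ rho.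
Proof. by rewrite -compA -(rcomodA rhoC) !compA assocK comp1m. Qed.

(** The coaction of v(S(h)) is never computed by itself: it is only met multiplied by that of v(h),
    so no formula for the coproduct of the antipode enters. *)
Lemma rho_coinv_proj : rho ∘ E = (E ⊗ unitH H) ∘ runiti B.
Proof.
(* Expanding b_0 as E(b_0) v(b_1) in the first leg of rho(b) gives rho(b) = E(b_0) rho(v(b_1)), with
   [B] acting on the first leg. *)
have rhoE : rho = (mulB ⊗ idm H) ∘ associ B B H ∘ (E ⊗ (rho ∘ v)) ∘ rho.
  rewrite vr -{1}[E]compm1 tensmM !compA -(compA (mulB ⊗ idm H)) associ_nat.
  rewrite !compA -(compA _ _ rho) -(compA _ (associ _ _ _)) compA -2!compA compA.
  rewrite (compA (associ _ _ _)) rho_coassoc_inv compA -!tens_compr.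
  by rewrite coinv_proj_conv tensm1 comp1m.
rewrite {1}coinv_projE /coinv_proj !compA rho_mul -(compA _ (rho ⊗ rho)) -tensmM compm1.
rewrite {1}rhoE.
set w := rho ∘ (v ∘ antipode H); set M := _ ∘ lmidbraid _ _ _ _.
have -> : ((mulB ⊗ idm H) ∘ associ B B H ∘ (E ⊗ (rho ∘ v)) ∘ rho) ⊗ w
   = ((mulB ⊗ idm H) ⊗ idm (B ⊗ H)) ∘ (associ B B H ⊗ idm (B ⊗ H))
     ∘ ((E ⊗ (rho ∘ v)) ⊗ w) ∘ (rho ⊗ idm H).
  rewrite -!tensmM !comp1m. by rewrite compm1.
rewrite !compA mul_tensor_linear -/M.
rewrite -(compA _ (assoc _ _ _)) assoc_nat !compA.
rewrite -(compA _ (assoc _ _ _)) -(compA _ _ rho) (rcomodA rhoC) !compA.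
rewrite -(compA _ (idm B ⊗ M)) -tensmM comp1m -(compA _ (E ⊗ _)) -tensmM compm1.
(* [M] is the product of [B ⊗ H] and [rho] is multiplicative, so this is rho(v(h_1) v(S(h_2))) =
   eps(h) rho(1). *)
have -> : M ∘ ((rho ∘ v) ⊗ w) ∘ comulH H = (unitB ⊗ unitH H) ∘ luniti munit ∘ counitH H.
  rewrite tensmM compA -rho_mul -!compA (compA mulB) v_antipode_r compA.
  by rewrite (rcomodalg_unit (bicomodalg_r hB)) !compA.
rewrite -[E in LHS]compm1 -!compA !tensmM.
rewrite -{1}[idm B]comp1m tensmM -!compA (rcomod1 rhoC).
rewrite (compA (associ _ _ _)) associ_nat !compA -tensmM comp1m (mul_unitr algB).
rewrite -triangle_inv !compA (comp_eql (assocK _ _ _)) compm1 -tensmM compm1.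
by rewrite -compA runitiK compm1.
Qed.

(** Generalised elements are used so that the notion covers [E] itself, before any splitting, as
    well as the inclusion [i]. *)
Definition coinvariant (X : C) (b : X ~> B) := rho ∘ b = (b ⊗ unitH H) ∘ runiti X.

(** * Products with a coinvariant factor *)

Section LeftFactor.
Variables (X : C) (b : X ~> B).
Hypothesis hb : coinvariant b.

Lemma rho_mull :
  rho ∘ mulB ∘ (b ⊗ idm B)
  = ((mulB ∘ (b ⊗ idm B)) ⊗ idm H) ∘ associ X B H ∘ (idm X ⊗ rho).
Proof.
rewrite rho_mul -compA -tensmM hb compm1.
rewrite -{1}[rho]comp1m tensmM -(tensm1 B H).
rewrite compA -(compA (mulB ⊗ mulH H)) lmidbraid_nat !compA -tensmM.
rewrite (alg1m (hopf_alg H)) (tens_split _ (lunit H)) (tens_split _ rho) !compA.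
by rewrite (comp_eql2 (lmidbraid_munitl _ _ _)).
Qed.

(** The [H]-leg of [b] is 1. On the left of a product it makes the middle braid trivial, as in
    [rho_mull]; on the right the [H]-leg of the other factor still has to pass [b], which leaves
    [endbraid]. *)
Lemma rho_mulr :
  rho ∘ mulB ∘ (idm B ⊗ b)
  = ((mulB ∘ (idm B ⊗ b)) ⊗ idm H) ∘ endbraid B H X ∘ (rho ⊗ idm X).
Proof.
rewrite rho_mul -compA -tensmM hb compm1.
rewrite -{1}[rho]comp1m tensmM -(tensm1 B H).
rewrite compA -(compA (mulB ⊗ mulH H)) lmidbraid_nat !compA -tensmM.
rewrite (algm1 (hopf_alg H)) (tens_split _ (runit H)) (tens_split' rho) !compA.
by rewrite (comp_eql2 (lmidbraid_munitr _ _ _)).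
Qed.

Lemma coinv_proj_mull : E ∘ mulB ∘ (b ⊗ idm B) = mulB ∘ (b ⊗ E).
Proof.
rewrite coinv_projE /coinv_proj -!compA (compA rho) rho_mull !compA.
rewrite -(compA mulB) -tensmM comp1m compm1 (mul_assoc algB).
by rewrite (comp_eql (associK _ _ _)) compm1 -compA -tensmM compm1.
Qed.

(** Write b as b 1, move b out of [E] by left linearity, and use E(1) = 1. *)
Lemma coinv_proj_fix : E ∘ b = b.
Proof.
have {1}-> : b = mulB ∘ (b ⊗ idm B) ∘ (idm X ⊗ unitB) ∘ runiti X.
  by rewrite -(compA mulB) -tens_split (mul_unitr algB) -compA runitiK compm1.
rewrite !compA coinv_proj_mull -(compA mulB) -tensmM compm1 coinv_proj_unit.
by rewrite (mul_unitr algB) -compA runitiK compm1.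
Qed.

Lemma rho_mul_v :
  rho ∘ mulB ∘ (v ⊗ b)
  = ((mulB ∘ (v ⊗ b)) ⊗ idm H) ∘ endbraid H H X ∘ (comulH H ⊗ idm X).
Proof.
rewrite (tens_split' v b) !compA rho_mulr -(compA _ (rho ⊗ _)) -tens_compr vr.
rewrite (tens_compr _ _ (comulH H)) !compA -(compA _ (endbraid _ _ _)).
rewrite endbraid_nat !compA.
by rewrite -tens_compr.
Qed.

(** As [b] has trivial coaction, the only braid in rho(v(h) b) moves h_2 past b, exactly as in the
    adjoint action. *)
Lemma adjoint_action_coinv :
  adjoint_action mulB v ∘ (idm H ⊗ b) = E ∘ mulB ∘ (v ⊗ b).
Proof.
rewrite coinv_projE /coinv_proj -!compA (compA rho) rho_mul_v !compA.
rewrite /adjoint_action -(compA _ (associ _ _ _)) associ_nat !compA.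
rewrite (comp_eql2 (endbraidE _ _ _)).
rewrite -!compA -!tensmM !comp1m !compm1.
rewrite (tens_split' (comulH H)) -(tensm1 H H) (compA (endbraid _ _ _)).
rewrite endbraid_nat !compA -2!(compA mulB) -!tensmM.
by rewrite -(compA _ (v ⊗ _)) -(compA _ (idm B ⊗ _)) -!tensmM !comp1m !compm1.
Qed.

Lemma mul_v_coinv :
  mulB ∘ (v ⊗ b)
  = mulB ∘ ((E ∘ mulB ∘ (v ⊗ b)) ⊗ v) ∘ endbraid H H X ∘ (comulH H ⊗ idm X).
Proof.
rewrite -[LHS]comp1m -coinv_proj_conv -!compA (compA rho) rho_mul_v !compA.
by rewrite -(compA mulB) -tensmM compm1 !compA.
Qed.

End LeftFactor.

Lemma coinv_proj_idem : E ∘ E = E.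
Proof. exact: (coinv_proj_fix rho_coinv_proj). Qed.

(** Since x v(h) = E(x_0) v(x_1 h), the coinvariant factor leaves [E], and [E ∘ v] is the
    multiplicative counit. *)
Lemma coinv_proj_mul_v : E ∘ (mulB ∘ (idm B ⊗ v))
  = E ∘ runit B ∘ (idm B ⊗ counitH H).
Proof.
have -> : mulB ∘ (idm B ⊗ v)
    = mulB ∘ (E ⊗ (v ∘ mulH H)) ∘ assoc B H H ∘ (rho ⊗ idm H).
  by rewrite vM -(mul_assoc algB) -compA -tensmM compm1 coinv_proj_conv.
rewrite (tens_split E) !compA (coinv_proj_mull rho_coinv_proj).
rewrite -(compA mulB (E ⊗ E)) -tensmM compm1 compA coinv_proj_v -(compA unitB) counit_mul.
have -> : E ⊗ (unitB ∘ (lunit munit ∘ counitH H ⊗ counitH H))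
    = (E ⊗ unitB) ∘ ((idm B ⊗ lunit munit) ∘ (idm B ⊗ (counitH H ⊗ counitH H))).
  by rewrite -!tensmM !compm1.
rewrite !compA (mul_unitr algB) -2!(compA (_ ∘ runit B)) -!compA.
rewrite (compA _ (assoc _ _ _)) -assoc_nat -(compA (assoc _ _ _)) -tensmM.
rewrite (rcomod1 rhoC) compm1 (compA (idm B ⊗ lunit munit)) triangle -tensmM.
by rewrite runitiK comp1m.
Qed.

(** Expand y as E(y_0) v(y_1) in E(x y); [coinv_proj_mul_v] then turns the trailing v(y_1) into a
    counit. *)
Lemma coinv_proj_mulr : E ∘ (mulB ∘ (idm B ⊗ E)) = E ∘ mulB.
Proof.
have {2}-> : mulB = mulB ∘ ((mulB ∘ (idm B ⊗ E)) ⊗ v) ∘ associ B B H ∘ (idm B ⊗ rho).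
  rewrite -(mul_associ algB) -compA -tensmM compm1 coinv_proj_conv tensm1.
  by rewrite compm1.
rewrite (tens_split' _ v) !compA -(compA E _ (idm B ⊗ v)) coinv_proj_mul_v.
rewrite -(compA _ (idm B ⊗ counitH H)) -tens_split' (tens_split (mulB ∘ _)) !compA.
rewrite -(compA E (runit B)) runit_nat -!compA.
rewrite (compA (idm (B ⊗ B) ⊗ _)) -(tensm1 B B) -associ_nat -compA -tens_compl.
by rewrite (rcomod1 rhoC) runiti_assoc runitiK compm1.
Qed.

(** * Yetter-Drinfeld algebra structure on the coinvariants, and the smash product *)

Section CoinvariantAlgebra.
Variables (A : C) (i : A ~> B) (p : B ~> A).
Hypothesis pi : p ∘ i = idm A.
Hypothesis ip : i ∘ p = E.

Lemma coinv_proj_i : E ∘ i = i.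
Proof. by rewrite -ip -compA pi compm1. Qed.

Lemma p_coinv_proj : p ∘ E = p.
Proof. by rewrite -ip compA pi comp1m. Qed.

Lemma coinvariant_i : coinvariant i.
Proof.
rewrite /coinvariant -{1}coinv_proj_i compA rho_coinv_proj -compA runiti_nat compA.
by rewrite -tensmM compm1 coinv_proj_i.
Qed.

(** The bicomodule law makes the right coaction on the second leg of lam(a) trivial, so [E]
    multiplies that leg by v(S(1)) = 1. *)
Lemma coinvariant_lcoaction : (idm H ⊗ E) ∘ (lam ∘ i) = lam ∘ i.
Proof.
rewrite coinv_projE /coinv_proj tens_compl -!compA (compA (idm H ⊗ rho)).
rewrite (bicomodalg_lr hB) -!compA coinvariant_i (compA (lam ⊗ _)) -tensmM.
rewrite comp1m (tens_split' (lam ∘ i)) -compA -runiti_nat -(tensm1 H B).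
rewrite (compA (assoc _ _ _)) assoc_nat -runiti_assoc -!compA.
rewrite (compA (assoc _ _ _)) associK comp1m !compA -!tens_compl.
rewrite -(compA mulB) -tensmM comp1m v_antipode_unit (algm1 algB) runitiK.
by rewrite tensm1 comp1m.
Qed.

Lemma coinv_proj_mul_i (X : C) (x : X ~> B) :
  E ∘ (mulB ∘ (i ⊗ x)) = mulB ∘ (i ⊗ (E ∘ x)).
Proof.
rewrite (tens_split i) !compA (coinv_proj_mull coinvariant_i).
by rewrite -compA -tensmM compm1.
Qed.

Lemma lcoaction_factors : exists! lamA : A ~> H ⊗ A, (idm H ⊗ i) ∘ lamA = lam ∘ i.
Proof.
exists ((idm H ⊗ p) ∘ (lam ∘ i)); split.
  by rewrite compA -tens_compl ip coinvariant_lcoaction.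
by move=> lamA <-; rewrite compA -tens_compl pi tensm1 comp1m.
Qed.

(** The structure on [A] is left abstract and enters only through its image in [B], which determines
    it because [i] and [idm H ⊗ i] are split monomorphisms. *)
Variables (mulA : A ⊗ A ~> A) (unitA : munit ~> A) (mu : H ⊗ A ~> A) (lamA : A ~> H ⊗ A).
Hypothesis iM : i ∘ mulA = mulB ∘ (i ⊗ i).
Hypothesis i1 : i ∘ unitA = unitB.
Hypothesis i_act : i ∘ mu = E ∘ (mulB ∘ (v ⊗ i)).
Hypothesis i_lam : (idm H ⊗ i) ∘ lamA = lam ∘ i.

Let i_alg : is_algebra_morphism mulA unitA mulB unitB i.
Proof. by split. Qed.

(* [exch] is h ⊗ a ↦ h_1 · a ⊗ h_2. *)
Variable exch : H ⊗ A ~> A ⊗ H.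
Hypothesis exchE : (mu ⊗ idm H) ∘ endbraid H H A ∘ (comulH H ⊗ idm A) = exch.

Lemma mul_v_i : mulB ∘ (v ⊗ i) = mulB ∘ (i ⊗ v) ∘ exch.
Proof.
rewrite {1}(mul_v_coinv coinvariant_i) -exchE -(compA E) -i_act !compA.
by rewrite -(compA mulB (i ⊗ v)) -tensmM compm1.
Qed.

(** In g · (h · a) = E(v(g) E(v(h) a)) the inner [E] is absorbed by [coinv_proj_mulr]. *)
Lemma coinvariant_module : is_module mu.
Proof.
split; apply: (split_mono pi); rewrite !compA i_act -!compA -!tensmM !compm1.
- rewrite vM (mul_assoc algB) (compA (v ⊗ i)) -tensmM compm1 i_act.
  rewrite -[v in v ⊗ (E ∘ _)]comp1m tensmM !compA -[in RHS](compA E).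
  by rewrite coinv_proj_mulr.
- by rewrite v1 (mul_unitl algB) compA coinv_proj_i.
Qed.

Lemma exch_midbraid (X : C) :
  (mu ⊗ idm (H ⊗ X)) ∘ lmidbraid H H A X ∘ (comulH H ⊗ idm (A ⊗ X))
  = assoc A H X ∘ (exch ⊗ idm X) ∘ associ H A X.
Proof.
rewrite lmidbraid_endbraid !compA -!tensm1 -assoc_nat -(compA _ (associ _ _ _)).
rewrite associ_nat !compA -2!(compA (assoc _ _ _)) -!tensmM.
by rewrite exchE !comp1m.
Qed.

Lemma coinv_proj_mul_i_v : E ∘ (mulB ∘ (i ⊗ v)) = i ∘ (runit A ∘ (idm A ⊗ counitH H)).
Proof.
rewrite (tens_split' i) (compA mulB) compA coinv_proj_mul_v -!compA -tensmM comp1m compm1.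
by rewrite (tens_split i) (compA (runit B)) runit_nat !compA coinv_proj_i.
Qed.

Lemma coinvariant_module_algebra : is_module_algebra mulA unitA mu.
Proof.
split.
- exact: (is_algebra_reflect algB pi i_alg).
- exact: coinvariant_module.
- apply: (split_mono pi); rewrite midbraidE !compA i_act iM.
  rewrite -!compA -tensmM compm1 iM (mul_associ algB) mul_v_i.
  (* Rebracketing (h_1 · a) v(h_2) b lets [E] pass the coinvariant h_1 · a and act on v(h_2) b,
     giving (h_1 · a)(h_2 · b). *)
  have -> : mulB ∘ ((mulB ∘ (i ⊗ v) ∘ exch) ⊗ i) ∘ associ H A A
     = mulB ∘ (i ⊗ (mulB ∘ (v ⊗ i))) ∘ (assoc A H A ∘ (exch ⊗ idm A) ∘ associ H A A).
    rewrite -[i in RHS]compm1 !compA -(mul_assoc algB) -(compA _ _ (exch ⊗ _)).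
    by rewrite -tensmM !compm1.
  rewrite compA coinv_proj_mul_i -i_act -exch_midbraid.
  by rewrite (tens_split' mu mu) -!compA (compA (i ⊗ i)) -tensmM compm1.
- apply: (split_mono pi); rewrite !compA i_act i1 -!compA -tensmM compm1 i1.
  by rewrite (mul_unitr algB) compA coinv_proj_v -compA.
Qed.

Lemma coinvariant_comodule_algebra : is_left_comodule_algebra mulA unitA lamA.
Proof.
apply: (is_left_comodule_algebra_reflect pi i_alg (bicomodalg_l hB)).
by rewrite /is_left_colinear i_lam.
Qed.

Lemma lam_mul_i_v :
  lam ∘ (mulB ∘ (i ⊗ v))
  = (mulH H ⊗ (mulB ∘ (i ⊗ v))) ∘ lmidbraid H A H H ∘ (lamA ⊗ comulH H).
Proof.
rewrite compA lam_mul -compA -tensmM vl -i_lam tensmM !compA.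
rewrite -(compA _ (lmidbraid _ _ _ _)) lmidbraid_nat tensm1 !compA -tensmM.
by rewrite compm1.
Qed.

Lemma lam_mul_v_i :
  lam ∘ (mulB ∘ (v ⊗ i))
  = (mulH H ⊗ (mulB ∘ (v ⊗ i))) ∘ lmidbraid H H H A ∘ (comulH H ⊗ lamA).
Proof.
rewrite compA lam_mul -compA -tensmM vl -i_lam tensmM !compA.
rewrite -(compA _ (lmidbraid _ _ _ _)) lmidbraid_nat tensm1 !compA -tensmM.
by rewrite compm1.
Qed.

Lemma coinvariant_yetter_drinfeld : is_yetter_drinfeld mu lamA.
Proof.
split; first exact: coinvariant_module.
  exact: lcomodalg_comod coinvariant_comodule_algebra.
rewrite midbraidE (comp_eql2 (endbraidE _ _ _)) (comp_eql2 (endbraidE _ _ _)).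
apply: (split_mono (tens_split_mono (comp1m (idm H)) pi)).
rewrite !compA -tensmM i_act comp1m -[mulH H in LHS]comp1m tensmM.
(* The left side folds to [idm H ⊗ E] applied to lam(v(h) a); the commutation rule replaces v(h) a
   by (h_1 · a) v(h_2) before [lam] is expanded again. *)
rewrite -!compA (compA (mulH H ⊗ _)) -lam_mul_v_i mul_v_i (compA lam) lam_mul_i_v.
rewrite (compA (mu ⊗ _)) exchE.
rewrite !compA -tensmM comp1m coinv_proj_mul_i_v.
(* By naturality the counit left by [E] moves before the middle braid and cancels a leg of
   [comulH H]; the braid then reduces to [endbraid]. *)
have -> : mulH H ⊗ (i ∘ (runit A ∘ (idm A ⊗ counitH H)))
    = (idm H ⊗ i) ∘ (mulH H ⊗ idm A) ∘ (idm (H ⊗ H) ⊗ runit A)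
      ∘ ((idm H ⊗ idm H) ⊗ (idm A ⊗ counitH H)).
  by rewrite -!tensmM tensm1 !comp1m !compm1 compA.
rewrite -(compA _ _ (lmidbraid _ _ _ _)) -lmidbraid_nat !compA.
rewrite -(compA _ _ (lamA ⊗ _)) -(tensmM _ lamA) tensm1 comp1m (coalgm1 (hopf_coalg H)).
by rewrite (tens_split' lamA) !compA (comp_eql2 (lmidbraid_munitr _ _ _)).
Qed.

(** In this form (a ⊗ g)(b ⊗ h) applies [exch] to g ⊗ b and then multiplies by a and h on the
    outside. *)
Lemma smash_mulE :
  smash_mul mulA mu = (mulA ⊗ mulH H) ∘ associ A A (H ⊗ H)
    ∘ (idm A ⊗ (assoc A H H ∘ (exch ⊗ idm H) ∘ associ H A H)) ∘ assoc A H (A ⊗ H).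
Proof.
rewrite /smash_mul midbraidE -exch_midbraid.
rewrite -(compA _ (lmidbraid _ _ _ _)) lmidbraid_assoc !compA.
rewrite (comp_eql (tens_split_mono (associK _ _ _) (comp1m (idm (H ⊗ H))))) compm1.
rewrite -(compA _ _ (associ _ _ _)) -associ_nat.
rewrite -(compA _ (assoc _ _ _)) assoc_nat !compA.
by rewrite !tens_compl !compA.
Qed.

Lemma mul_i_v_smash :
  is_algebra_morphism (smash_mul mulA mu) (smash_unit H unitA) mulB unitB
    (mulB ∘ (i ⊗ v)).
Proof.
split.
(* Both sides equal a v(g) b v(h): [mul_v_i] turns the inner exchange back into v(g) b. *)
- rewrite smash_mulE !compA -(compA mulB (i ⊗ v)) -tensmM iM vM.
  rewrite -(mul_associ algB) -(compA mulB) -tensmM compm1 !compA.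
  rewrite -(mul_assoc algB) -(compA mulB _ (exch ⊗ _)) -tensmM compm1 -mul_v_i.
  by rewrite -(mul_associ algB) -(mul_assoc algB).
- rewrite /smash_unit compA -(compA mulB) -tensmM i1 v1 (mul_unitr algB).
  by rewrite -compA luniti_runiti_munit runitiK compm1.
Qed.

Lemma mul_i_v_lcolinear :
  is_left_colinear (smash_lcoaction lamA) lam (mulB ∘ (i ⊗ v)).
Proof.
rewrite /is_left_colinear lam_mul_i_v /smash_lcoaction midbraidE !compA -tensmM.
by rewrite comp1m compm1.
Qed.

Lemma mul_i_v_rcolinear :
  is_right_colinear (smash_rcoaction H A) rho (mulB ∘ (i ⊗ v)).
Proof.
rewrite /is_right_colinear /smash_rcoaction (tens_split i v) !compA.
rewrite (rho_mull coinvariant_i) -[LHS]compA -tens_compl vr tens_compl !compA.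
by rewrite -(compA _ (associ _ _ _)) associ_nat !compA -tens_compr.
Qed.

(** By right colinearity a v(h) is sent to p(a v(h_1)) ⊗ h_2, and [p] = [p ∘ E] reduces this to a
    eps(h_1) ⊗ h_2. *)
Lemma mul_i_vK : ((p ⊗ idm H) ∘ rho) ∘ (mulB ∘ (i ⊗ v)) = idm (A ⊗ H).
Proof.
rewrite -compA mul_i_v_rcolinear compA -tens_compr -p_coinv_proj -(compA p).
rewrite coinv_proj_mul_i_v compA pi comp1m /smash_rcoaction tens_compr !compA.
rewrite -(compA _ _ (associ _ _ _)) -associ_nat -!compA -tens_compl.
rewrite (coalg1m (hopf_coalg H)) -triangle_inv (compA (associ _ _ _)) assocK comp1m.
by rewrite -tens_compr runitiK tensm1.
Qed.

Lemma mul_i_vVK : (mulB ∘ (i ⊗ v)) ∘ ((p ⊗ idm H) ∘ rho) = idm B.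
Proof.
by rewrite compA -(compA mulB) -tensmM ip compm1 coinv_proj_conv.
Qed.

End CoinvariantAlgebra.
End Coinvariants.

Theorem theorem3p7
  (C : BraidedCategory) (hC : admits_split_idempotents C)
  (H : HopfAlgebra C) (hS : is_iso (antipode H)) (hflat : flat (hopf_obj H))
  (B : C) (mulB : B ⊗ B ~> B) (unitB : munit ~> B)
  (lam : B ~> H ⊗ B) (rho : B ~> B ⊗ H)
  (hB : is_bicomodule_algebra mulB unitB lam rho)
  (v : H ~> B)
  (hv : is_bicomodule_algebra_morphism
          (mulH H) (unitH H) (comulH H) (comulH H) mulB unitB lam rho v) :
  let E : B ~> B := coinv_proj mulB rho v in
  idempotent E /\
  (exists (B0 : C) (i : B0 ~> B) (p : B ~> B0), splits E i p) /\
  forall (B0 : C) (i : B0 ~> B) (p : B ~> B0), splits E i p ->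
    let mul0 : B0 ⊗ B0 ~> B0 := p ∘ mulB ∘ (i ⊗ i) in
    let unit0 : munit ~> B0 := p ∘ unitB in
    let ad0 : H ⊗ B0 ~> B0 := p ∘ adjoint_action mulB v ∘ (idm H ⊗ i) in
    (exists! lam0 : B0 ~> H ⊗ B0, (idm H ⊗ i) ∘ lam0 = lam ∘ i) /\
    forall lam0 : B0 ~> H ⊗ B0, (idm H ⊗ i) ∘ lam0 = lam ∘ i ->
      is_yetter_drinfeld_algebra mul0 unit0 ad0 lam0 /\
      is_bicomodule_algebra
        (smash_mul mul0 ad0) (smash_unit H unit0)
        (smash_lcoaction lam0) (smash_rcoaction H B0) /\
      is_bicomodule_algebra_iso
        (smash_mul mul0 ad0) (smash_unit H unit0)
        (smash_lcoaction lam0) (smash_rcoaction H B0)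
        mulB unitB lam rho
        (mulB ∘ (i ⊗ v)).

Proof.
move=> E; have EE : E = coinv_proj mulB rho v by [].
move: E EE => E EE.
split; first exact: (coinv_proj_idem hB hv EE).
split; first by apply: hC; exact: (coinv_proj_idem hB hv EE).
move=> B0 i p [pi ip] mul0 unit0 ad0.
have iM : i ∘ mul0 = mulB ∘ (i ⊗ i).
  by rewrite /mul0 !compA ip -compA (coinv_proj_mul_i hB hv EE pi ip)
             (coinv_proj_i pi ip).
have i1 : i ∘ unit0 = unitB.
  by rewrite /unit0 compA ip (coinv_proj_unit hv EE).
have i_act : i ∘ ad0 = E ∘ (mulB ∘ (v ⊗ i)).
  rewrite /ad0 -(compA p).
  rewrite (adjoint_action_coinv hB hv EE (coinvariant_i hB hv EE pi ip)).
  by rewrite !compA ip (coinv_proj_idem hB hv EE).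
(* The bodies of the structure maps are dropped; only their images under [i] are kept. *)
move: mul0 unit0 ad0 iM i1 i_act => mul0 unit0 ad0 iM i1 i_act.
split; first exact: (lcoaction_factors hB hv EE pi ip).
move=> lam0 i_lam.
(* This fixes [exch] to be the displayed composite. *)
have exchE := eq_refl ((ad0 ⊗ idm H) ∘ endbraid H H B0 ∘ (comulH H ⊗ idm B0)).
have smA := mul_i_v_smash hB hv EE pi ip iM i1 i_act exchE.
have lA := mul_i_v_lcolinear hB hv i_lam.
have rA := mul_i_v_rcolinear hB hv EE pi ip.
have vK := mul_i_vK hB hv EE pi ip.
split.
  apply/yetter_drinfeld_algebraE; split.
  - exact: (coinvariant_yetter_drinfeld hB hv EE pi ip iM i1 i_act i_lam exchE).
  - exact: (coinvariant_module_algebra hB hv EE pi ip iM i1 i_act exchE).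
  - exact: (coinvariant_comodule_algebra hB pi iM i1 i_lam).
(* The smash product inherits its axioms from [B], being embedded by omega with retraction
   [(p ⊗ idm H) ∘ rho]. *)
split; first exact: (is_bicomodule_algebra_reflect vK smA hB lA rA).
exact: (is_bicomodule_algebra_isoI vK smA lA rA (mul_i_vVK hB hv EE ip)).
Qed.
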